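(* Let $X\in\mathbf{R}^{n\times p}$ with rows $x_1,\dots,x_n\in\mathbf{R}^p$, let $P=\operatorname{conv}\{x_1,\dots,x_n\}$, and let $h_1,\dots,h_k$ be the extreme points of $P$. For each $i$ let $\omega_i=\Pr(z\in N_P(h_i))$, $z\sim\mathcal{N}(0,I_p)$, be the solid angle of the normal cone of $P$ at $h_i$. Consider the following procedure (the proto-algorithm): generate a $p\times m$ random matrix $G$ with independent standard normal entries, form $XG$, let $I_{\max}$ and $I_{\min}$ be the sets of row indices attaining the maximum and the minimum, respectively, in each column of $XG$, and return the rows of $X$ indexed by $I_{\max}\cup I_{\min}$. Let $\delta\in(0,1)$. If $$m>\kappa\log\left(\frac{k}{\delta}\right),\qquad \kappa=\frac{1}{\log\left(\frac{1}{\max_i(1-2\omega_i)}\right)},$$ then with probability at least $1-\delta$ the returned rows include all $k$ extreme points $h_1,\dots,h_k$.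
   Context: For a convex set $C\subset\mathbf{R}^p$ and $x\in C$, the normal cone is $N_C(x)=\{w\in\mathbf{R}^p : w^T(y-x)\le 0\text{ for all }y\in C\}$. The solid angle of a cone $K\subset\mathbf{R}^p$ (full-dimensional) is $\omega(K)=\Pr(z\in K)$ for $z\sim\mathcal{N}(0,I_p)$. *)

(* Defs.v *)
From HB Require Import structures.
From mathcomp Require Import all_boot all_order all_algebra.
From mathcomp Require Import all_classical all_reals all_analysis.
From mathcomp Require Import normal_distribution.

Set Implicit Arguments.
Unset Strict Implicit.
Unset Printing Implicit Defensive.

Import Order.TTheory GRing.Theory Num.Theory.

Local Open Scope classical_set_scope.
Local Open Scope ring_scope.

Section Geometry.
Variables (R : realType) (p : nat).

Definition dotp (u v : 'rV[R]_p) : R := \sum_(j < p) u 0 j * v 0 j.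

Definition conv_rows (n : nat) (X : 'M[R]_(n, p)) : set 'rV[R]_p :=
  [set y | exists c : 'I_n -> R,
     [/\ (forall i, 0 <= c i), \sum_(i < n) c i = 1 &
         y = \sum_(i < n) c i *: row i X]].

Definition extreme_point (C : set 'rV[R]_p) (x : 'rV[R]_p) : Prop :=
  C x /\ forall (a b : 'rV[R]_p) (t : R), C a -> C b -> 0 < t < 1 ->
    x = t *: a + (1 - t) *: b -> a = x /\ b = x.

Definition normal_cone (C : set 'rV[R]_p) (x : 'rV[R]_p) : set 'rV[R]_p :=
  [set w | forall y, C y -> dotp w (y - x) <= 0].

End Geometry.

Section Probability.
Context {d : measure_display} {T : measurableType d} {R : realType}.

Definition mutually_independent (P : probability T R) (I : finType)
    (Y : I -> T -> R) : Prop :=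
  (forall i, measurable_fun setT (Y i)) /\
  forall (S : {set I}) (A : I -> set R), (forall i, measurable (A i)) ->
    P (\bigcap_(i in [set` S]) (Y i @^-1` A i)) =
    (\prod_(i in S) P (Y i @^-1` A i))%E.

Definition iid_std_normal (P : probability T R) (I : finType)
    (Y : I -> T -> R) : Prop :=
  mutually_independent P Y /\
  forall i (A : set R), measurable A -> P (Y i @^-1` A) = normal_prob 0 1 A.

End Probability.

(* omega is the solid angle of the cone K in R^p:
   omega = Pr(z \in K) for z ~ N(0, I_p), whatever probability space
   carries the standard Gaussian vector z. *)
Definition solid_angle_is (R : realType) (p : nat) (K : set 'rV[R]_p)
    (omega : R) : Prop :=
  forall (d : measure_display) (T : measurableType d) (Q : probability T R)
         (z : 'I_p -> T -> R),
    iid_std_normal Q z -> Q [set t | K (\row_j z j t)] = omega%:E.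

Definition XG_entry (R : realType) (T : Type) (n p m : nat)
    (X : 'M[R]_(n, p)) (G : 'I_p -> 'I_m -> T -> R)
    (t : T) (j : 'I_n) (l : 'I_m) : R :=
  \sum_(q < p) X j q * G q l t.

Definition selected (R : realType) (T : Type) (n p m : nat)
    (X : 'M[R]_(n, p)) (G : 'I_p -> 'I_m -> T -> R) (t : T) (j : 'I_n) : Prop :=
  exists l : 'I_m,
    (forall j', XG_entry X G t j' l <= XG_entry X G t j l) \/
    (forall j', XG_entry X G t j l <= XG_entry X G t j' l).

(* Main.v *)
Require Import Defs.
From HB Require Import structures.
From mathcomp Require Import all_boot all_order all_algebra.
From mathcomp Require Import all_classical all_reals all_analysis.
From mathcomp Require Import normal_distribution.
From mathcomp Require Import measurable_realfun ring lra.
Import Order.TTheory GRing.Theory Num.Theory numFieldNormedType.Exports.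
Local Open Scope classical_set_scope.
Local Open Scope ring_scope.

(** A column g of G returns the extreme point h exactly when g or -g lies in
    the normal cone N of P at h.  If P is not a single point, N and -N meet
    inside a hyperplane, which is Gaussian-null, so by symmetry a column misses
    h with probability 1 - 2 omega; the columns being independent, all of them
    miss h with probability (1 - 2 omega)^m, and a union bound over the k
    extreme points concludes.

    The hypothesis on m also has to exclude m = 0 and kappa = 1/0, for which
    every omega must be positive: by Gordan's alternative an extreme point is
    exposed, hence N contains a box, and a box has positive Gaussian measure.
    As the given space carries no Gaussian vector when m = 0, this is computed
    on a product of copies of the standard normal law. *)

(** * Separation of finite families of vectors *)

Section Geometry.
Context {R : realType} {p : nat}.
Implicit Types (u v w x h : 'rV[R]_p).

Lemma dotpDl u v w : dotp (u + v) w = dotp u w + dotp v w.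
Proof. by rewrite -big_split; apply: eq_bigr => j _; rewrite mxE mulrDl. Qed.

Lemma dotpDr u v w : dotp w (u + v) = dotp w u + dotp w v.
Proof. by rewrite -big_split; apply: eq_bigr => j _; rewrite mxE mulrDr. Qed.

Lemma dotpZl (a : R) v w : dotp (a *: v) w = a * dotp v w.
Proof. by rewrite mulr_sumr; apply: eq_bigr => j _; rewrite mxE mulrA. Qed.

Lemma dotpZr (a : R) v w : dotp w (a *: v) = a * dotp w v.
Proof. by rewrite mulr_sumr; apply: eq_bigr => j _; rewrite mxE mulrCA. Qed.

Lemma dotpNl v w : dotp (- v) w = - dotp v w.
Proof. by rewrite -scaleN1r dotpZl mulN1r. Qed.

Lemma dotpBr u v w : dotp w (u - v) = dotp w u - dotp w v.
Proof. by rewrite dotpDr -scaleN1r dotpZr mulN1r. Qed.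

Lemma dotp_sumr (I : Type) (r : seq I) (F : I -> 'rV[R]_p) w :
  dotp w (\sum_(i <- r) F i) = \sum_(i <- r) dotp w (F i).
Proof.
elim: r => [|i r IH]; last by rewrite !big_cons dotpDr IH.
by rewrite !big_nil /dotp big1 // => j _; rewrite mxE mulr0.
Qed.

Lemma dotp_gt0 v : v != 0 -> 0 < dotp v v.
Proof.
move=> v0; rewrite lt_neqAle sumr_ge0 => [|j _]; last by rewrite -expr2 sqr_ge0.
rewrite andbT eq_sym; apply: contra v0 => /eqP /psumr_eq0P v0.
apply/eqP/rowP => j; rewrite mxE; apply/eqP.
by rewrite -sqrf_eq0 expr2 v0 // => i _; rewrite -expr2 sqr_ge0.
Qed.

(** Finitely many strict inequalities tolerate a common perturbation. As [f i < 0], any positive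
    step below a tolerated one is tolerated, so the minimum over the list works. *)
Lemma finite_small_step {I : eqType} (s : seq I) (f g : I -> R) :
  (forall i, i \in s -> f i < 0) ->
  exists2 e, 0 < e & forall i, i \in s -> f i + e * g i < 0.
Proof.
elim: s => [|i s IH] fN; first by exists 1.
have [|e e0 He] := IH; first by move=> j js; apply: fN; rewrite inE js orbT.
have fi : f i < 0 by apply: fN; rewrite inE eqxx.
(* The summand 1 keeps the denominator positive and makes [g i] strictly smaller than it, so that
   [f i + e' * g i < 0]. *)
pose e' := - f i / (`|g i| + 1).
have gi : 0 < `|g i| + 1 by rewrite ltr_wpDl.
have e'0 : 0 < e' by rewrite divr_gt0 ?oppr_gt0.
have step (a r b c : R) : 0 < a -> a <= b -> c < 0 -> c + b * r < 0 -> c + a * r < 0.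
  move=> a0 ab c0; case: (lerP r 0) => r0 H; first by nra.
  by rewrite (le_lt_trans _ H) // lerD2l ler_wpM2r // ltW.
exists (Num.min e e'); first by rewrite lt_min e0 e'0.
have m0 : 0 < Num.min e e' by rewrite lt_min e0 e'0.
move=> j; rewrite inE => /orP[/eqP ->|js].
  apply: (@step _ _ e') => //; first by rewrite ge_min lexx orbT.
  rewrite /e' mulrAC -{1}(opprK (f i)) addrC subr_lt0 ltr_pdivrMr //.
  by rewrite ltr_pM2l ?oppr_gt0 // (le_lt_trans (ler_norm _)) // ltrDl.
apply: (@step _ _ e); rewrite ?He ?ge_min ?lexx //.
by apply: fN; rewrite inE js orbT.
Qed.

(* When w separates the tail of the family but is positive on its head a i0,
   the induction hypothesis is applied to the vectors a i moved along a i0 into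
   the orthogonal complement of w. *)
Lemma gordan {I : eqType} (s : seq I) (a : I -> 'rV[R]_p) : uniq s ->
  (exists w, forall i, i \in s -> dotp w (a i) < 0) \/
  (exists c : I -> R, [/\ forall i, 0 <= c i, exists2 i, i \in s & 0 < c i &
     \sum_(i <- s) c i *: a i = 0]).
Proof.
elim: s a => [a _|i0 s IH a /= /andP[i0s us]]; first by left; exists 0.
have neq i : i \in s -> (i == i0) = false.
  by move=> iS; apply: contraNF i0s => /eqP <-.
have extend (c : I -> R) (d : R) : 0 <= d -> (forall i, 0 <= c i) ->
    d *: a i0 + \sum_(i <- s) c i *: a i = 0 ->
    (0 < d \/ exists2 i, i \in s & 0 < c i) ->
    exists c : I -> R, [/\ forall i, 0 <= c i, exists2 i, i \in i0 :: s & 0 < c i &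
     \sum_(i <- i0 :: s) c i *: a i = 0].
  move=> d0 c0 E H; exists (fun i => if i == i0 then d else c i); split.
  - by move=> i; case: ifP.
  - case: H => [dp|[i iS ci]]; first by exists i0; rewrite ?inE eqxx.
    by exists i; rewrite ?inE ?iS ?orbT // neq.
  - rewrite big_cons eqxx -[RHS]E; congr (_ + _).
    by rewrite big_seq [RHS]big_seq; apply: eq_bigr => i /neq ->.
have [[w Hw]|[c [c0 cp E]]] := IH a us; last first.
  by right; apply: (extend c 0) => //; [rewrite scale0r add0r|right].
case: (ltrgtP (dotp w (a i0)) 0) => wi0.
- by left; exists w => i; rewrite inE => /orP[/eqP ->|/Hw].
- pose r i := - dotp w (a i) / dotp w (a i0).
  have r0 i : i \in s -> 0 < r i by move=> /Hw ?; rewrite divr_gt0 ?oppr_gt0.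
  have [[v Hv]|[c [c0 cp E]]] := IH (fun i => a i + r i *: a i0) us.
    left; have [e e0 He] := finite_small_step s (fun i => dotp v (a i + r i *: a i0)) r Hv.
    (* [lam] gives [v + lam *: w] the value [- e] at [a i0]. Adding a multiple of [w] leaves the
       values at the moved vectors unchanged, as these are orthogonal to [w]. *)
    pose lam := - (dotp v (a i0) + e) / dotp w (a i0).
    have Ei0 : dotp (v + lam *: w) (a i0) = - e.
      by rewrite dotpDl dotpZl /lam divfK ?gt_eqF // opprD addrA subrr sub0r.
    exists (v + lam *: w) => i; rewrite inE => /orP[/eqP ->|iS].
      by rewrite Ei0 oppr_lt0.
    have := He _ iS; suff -> : dotp (v + lam *: w) (a i) =
      dotp v (a i + r i *: a i0) + e * r i by [].
    have -> : a i = (a i + r i *: a i0) - r i *: a i0 by rewrite addrK.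
    rewrite dotpBr [dotp _ (r i *: _)]dotpZr Ei0 mulrN opprK (mulrC (r i)).
    rewrite subrK dotpDl dotpZl [dotp w _]dotpDr dotpZr /r divfK ?gt_eqF //.
    by rewrite subrr mulr0 addr0.
  (* A relation among the moved vectors unfolds into one among the [a i], where [a i0] collects the
     weight [c i * r i] from each [i]. *)
  right; apply: (extend (fun i => if i \in s then c i else 0)
                  (\sum_(i <- s) c i * r i)).
  + by rewrite big_seq sumr_ge0 // => i iS; rewrite mulr_ge0 // ltW // r0.
  + by move=> i; case: ifP.
  + rewrite -[RHS]E scaler_suml -big_split /= big_seq [RHS]big_seq.
    by apply: eq_bigr => i iS; rewrite iS scalerDr scalerA addrC.
  + by right; case: cp => i iS ci; exists i; rewrite ?iS.
(* If [w] is orthogonal to [a i0], either [a i0 = 0] is itself a relation, or tilting [w] slightly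
   towards [- a i0] separates the head as well. *)
- have [a0|a0] := eqVneq (a i0) 0.
    right; apply: (extend (fun=> 0) 1); rewrite ?a0 ?scaler0 ?add0r //.
      by rewrite big1 // => i _; rewrite scale0r.
    by left.
  left; have [e e0 He] := finite_small_step s (fun i => dotp w (a i))
    (fun i => - dotp (a i0) (a i)) Hw.
  exists (w - e *: a i0) => i; rewrite inE dotpDl dotpNl dotpZl => /orP[/eqP ->|iS].
    by rewrite wi0 sub0r oppr_lt0 mulr_gt0 ?dotp_gt0.
  by rewrite -mulrN He.
Qed.

(** * Extreme points and normal cones of a finite convex hull *)

Section Rows.
Context {n : nat} (X : 'M[R]_(n, p)).

Lemma conv_rows_row j : conv_rows X (row j X).
Proof.
exists (fun i => (i == j)%:R); split.
- by move=> i; rewrite ler0n.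
- by rewrite (bigD1 j) //= eqxx big1 ?addr0 // => i /negbTE ->.
- rewrite (bigD1 j) //= eqxx scale1r big1 ?addr0 // => i /negbTE ->.
  by rewrite scale0r.
Qed.

(** A linear inequality on the rows passes to their convex combinations. The cone thus becomes a
    finite intersection of half-spaces, the form used for measurability and for row selection. *)
Lemma normal_coneE x w :
  normal_cone (conv_rows X) x w <-> forall j, dotp w (row j X - x) <= 0.
Proof.
split=> [H j|H y [c [c0 c1 ->]]]; first by apply: H; exact: conv_rows_row.
have -> : \sum_i c i *: row i X - x = \sum_i c i *: (row i X - x).
  under [RHS]eq_bigr do rewrite scalerBr.
  by rewrite sumrB -scaler_suml c1 scale1r.
rewrite dotp_sumr sumr_le0 // => i _.
by rewrite dotpZr mulr_ge0_le0.
Qed.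

(* A row carrying weight in a representation of x keeps half of its weight
   when it is split off, so that the complementary weights stay nonnegative. *)
Lemma extreme_point_weight x (c : 'I_n -> R) j :
  extreme_point (conv_rows X) x -> (forall i, 0 <= c i) -> 0 < c j ->
  \sum_i c i *: (row i X - x) = 0 -> row j X = x.
Proof.
move=> [_ ext] c0 cj E; pose s := \sum_i c i.
have s_ge : c j <= s by rewrite /s (bigD1 j) //= lerDl sumr_ge0.
have s0 : 0 < s by exact: lt_le_trans cj s_ge.
pose t := c j / s / 2.
have cjs : c j / s <= 1 by rewrite ler_pdivrMr // mul1r.
have cjs0 : 0 < c j / s by rewrite divr_gt0.
have t01 : 0 < t < 1 by rewrite /t; lra.
have t10 : 1 - t != 0 by rewrite gt_eqF //; lra.
(* Weights of what remains after mass [t] is taken from row [j]. Dividing by [s] is needed because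
   the [c i] have an arbitrary positive sum. *)
pose c' i := (c i / s - (i == j)%:R * t) / (1 - t).
have sumc : \sum_i c' i = 1.
  rewrite -mulr_suml sumrB -mulr_suml -mulr_suml divff ?gt_eqF //.
  rewrite (bigD1 j) //= eqxx big1 => [|i /negbTE -> //].
  by rewrite addr0 mul1r divff.
have Ex : \sum_i (c i / s) *: row i X = x.
  have : \sum_i c i *: row i X = s *: x.
    apply/eqP; rewrite -subr_eq0 -[X in _ == X]E; apply/eqP.
    under [RHS]eq_bigr do rewrite scalerBr.
    by rewrite sumrB -scaler_suml.
  move=> /(congr1 (GRing.scale s^-1)); rewrite scalerA mulVf ?gt_eqF // scale1r.
  move=> <-; rewrite scaler_sumr; apply: eq_bigr => i _.
  by rewrite scalerA mulrC.
apply: (proj1 (ext (row j X) (\sum_i c' i *: row i X) t _ _ _ _)) => //.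
- exact: conv_rows_row.
- exists c'; split=> // i; rewrite /c' divr_ge0 //; last by lra.
  have ci : 0 <= c i / s by rewrite divr_ge0 // ltW.
  by have [->|_] := eqVneq i j; rewrite ?mul1r ?mul0r /t; lra.
- have -> : (1 - t) *: (\sum_i c' i *: row i X) =
      \sum_i (c i / s - (i == j)%:R * t) *: row i X.
    rewrite scaler_sumr; apply: eq_bigr => i _.
    by rewrite scalerA /c' mulrC divfK.
  under eq_bigr do rewrite scalerBl.
  rewrite sumrB Ex (bigD1 j) //= eqxx mul1r [X in - (_ + X)]big1 => [|i /negbTE ->].
    by rewrite addr0 subrKC.
  by rewrite mul0r scale0r.
Qed.

Lemma extreme_point_row x :
  extreme_point (conv_rows X) x -> exists j, row j X = x.
Proof.
move=> ex; have [[c [c0 c1 Ec]] _] := ex.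
have [j cj] : exists j, 0 < c j.
  apply: contrapT => H; have : \sum_i c i <= 0.
    by apply: sumr_le0 => i _; rewrite leNgt; apply/negP => ci; apply: H; exists i.
  by rewrite c1 ler10.
exists j; apply: (extreme_point_weight _ c) => //.
under eq_bigr do rewrite scalerBr.
by rewrite sumrB -scaler_suml c1 scale1r -Ec subrr.
Qed.

(** Gordan's alternative for the differences [row j X - x] over the rows other than [x]: a
    nontrivial nonnegative relation would put positive weight on such a row, which extremality
    forces to equal [x]. *)
Lemma extreme_point_exposed x : extreme_point (conv_rows X) x ->
  exists w, forall j, row j X != x -> dotp w (row j X - x) < 0.
Proof.
move=> ex; pose s := [seq j <- enum 'I_n | row j X != x].
have us : uniq s by rewrite filter_uniq // enum_uniq.
have [[w Hw]|[c [c0 [j js cj] E]]] := gordan s (fun j => row j X - x) us.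
  by exists w => j jx; apply: Hw; rewrite mem_filter jx mem_enum.
exfalso; move: js; rewrite mem_filter => /andP[jx _].
suff /eqP : row j X = x by rewrite (negbTE jx).
(* Weight 0 on the rows equal to [x] turns the relation over [s] into one over all rows. *)
apply: (extreme_point_weight _ (fun j => if row j X != x then c j else 0)) => //.
- by move=> i; case: ifP.
- by rewrite jx.
- rewrite -[RHS]E /s big_filter big_enum_cond /= [RHS]big_mkcond /=.
  by apply: eq_bigr => i _; case: ifP => // _; rewrite scale0r.
Qed.

(** The strict inequalities of an exposing [w] survive a change of each coordinate by less than [e],
    which moves the product with [row j X - x] by at most [e] times the sum of its absolute
    entries. *)
Lemma normal_cone_contains_box x : extreme_point (conv_rows X) x ->
  exists w, exists2 e : R, 0 < e &
    forall v, (forall j, `|v 0 j - w 0 j| < e) -> normal_cone (conv_rows X) x v.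
Proof.
move=> /extreme_point_exposed[w Hw]; exists w.
pose s := [seq j <- enum 'I_n | row j X != x].
have [|e e0 He] := finite_small_step s (fun j => dotp w (row j X - x))
  (fun j => \sum_q `|(row j X - x) 0 q|).
  by move=> j; rewrite mem_filter => /andP[/Hw].
exists e => // v vw; apply/normal_coneE => j.
have [->|jx] := eqVneq (row j X) x.
  by rewrite dotpBr subrr.
have /He/ltW : j \in s by rewrite mem_filter jx mem_enum.
apply: le_trans; rewrite -lerBlDl -dotpNl -dotpDl.
rewrite [leRHS]mulr_sumr; apply: ler_sum => q _; rewrite !mxE.
rewrite (le_trans (ler_norm _)) // normrM ler_wpM2r //.
exact: ltW (vw q).
Qed.

End Rows.
End Geometry.

(** * The standard normal law on the line *)

Section StandardNormal.
Context {R : realType}.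
Local Notation mu := (@lebesgue_measure R).
Local Notation gauss := (@normal_prob R 0 1).

Lemma normal_pdfN (x : R) : normal_pdf 0 1 (- x) = normal_pdf 0 1 x.
Proof. by rewrite !normal_pdfE ?oner_eq0 // /normal_fun !subr0 sqrrN. Qed.

Lemma normal_prob_set1 (x : R) : gauss [set x] = 0%E.
Proof. by rewrite /normal_prob integral_set1. Qed.

(** The law and its reflection agree on the half-lines [[x, +oo[], by substitution and evenness of
    the density. These half-lines are stable under intersection and generate the Borel sets. *)
Lemma normal_prob_opp (A : set R) : measurable A ->
  gauss (-%R @^-1` A) = gauss A.
Proof.
move=> mA.
have mN : @measurable_fun _ _ (measurableTypeR R) (measurableTypeR R) setT -%R.
  exact: oppr_measurable.
pose oppm : {mfun measurableTypeR R >-> measurableTypeR R} :=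
  @mfun_Sub _ _ (measurableTypeR R) (measurableTypeR R) -%R (mem_set mN).
suff : gauss A = distribution (normal_prob 0 1) oppm A by move->.
pose m1 : {measure set (measurableTypeR R) -> \bar R} := normal_prob 0 1.
pose m2 : {measure set (measurableTypeR R) -> \bar R} :=
  distribution (normal_prob 0 1) oppm.
change (m1 A = m2 A).
refine (@measure_unique _ R (measurableTypeR R) (@RGenCInfty.G R)
  (fun n => `[- n%:R, +oo[%classic) _ _ _ _ m1 m2 _ _ A mA) => //.
- exact: RGenCInfty.measurableE.
- move=> _ _ [x ->] [y ->]; exists (Num.max x y).
  apply/seteqP; split => z; rewrite /= !in_itv /= !andbT ge_max.
    by case=> -> ->.
  by case/andP.
- by move=> i; exists (- i%:R).
- apply/seteqP; split=> // x _; exists (Num.bound `|x|) => //=.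
  rewrite in_itv /= andbT lerNl (le_trans (ler_norm _)) // normrN.
  by rewrite ltW // archi_boundP.
- move=> _ [x ->].
  rewrite /distribution /pushforward /=.
  have -> : -%R @^-1` `[x, +oo[%classic = `]-oo, (- x)]%classic.
    by apply/seteqP; split => y /=; rewrite !in_itv /= ?andbT lerNr.
  rewrite /normal_prob ge0_integration_by_substitutionNy.
  + by apply: eq_integral => y _ /=; rewrite normal_pdfN.
  + by apply: continuous_subspaceT => y; apply: continuous_normal_pdf; rewrite oner_eq0.
  + by move=> y _; exact: normal_pdf_ge0.
- move=> k; apply: le_lt_trans (probability_le1 _ _) _ => //.
  exact: ltry.
Qed.

Lemma normal_prob_itv_gt0 (a b : R) : a < b -> (0 < gauss `]a, b[%classic)%E.
Proof.
move=> ab; pose M := Num.max `|a| `|b|.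
(* The density at [M], which is its lower bound on the interval since [|x| <= M] there. *)
pose c : R := normal_peak 1 * expR (- M ^+ 2 / 2).
have c0 : 0 < c by rewrite mulr_gt0 ?expR_gt0 // normal_peak_gt0 ?oner_eq0.
apply: (@lt_le_trans _ _ (\int[mu]_(x in `]a, b[) (c%:E))%E).
  rewrite integral_cst //= lebesgue_measure_itv /= lte_fin ab.
  by rewrite -EFinB -EFinM lte_fin mulr_gt0 // subr_gt0.
apply: ge0_le_integral => //=.
- by move=> x _; rewrite lee_fin ltW.
- apply/measurable_EFinP; apply: measurable_funTS; exact: measurable_normal_pdf.
- move=> x; rewrite /= in_itv /= => /andP[ax xb]; rewrite lee_fin.
  rewrite normal_pdfE ?oner_eq0 // ler_wpM2l ?normal_peak_ge0 //.
  rewrite /normal_fun ler_expR subr0 expr1n ler_wpM2r ?invr_ge0 // lerN2.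
  rewrite -[leLHS]real_normK ?num_real // lerXn2r ?nnegrE ?normr_ge0 //.
    by rewrite /M le_max normr_ge0.
  rewrite /M le_max; case: (lerP 0 x) => x0.
    by apply/orP; right; rewrite (ger0_norm x0) ler_normr; apply/orP; left; lra.
  by apply/orP; left; rewrite (ltr0_norm x0) ler_normr; apply/orP; right; lra.
Qed.

End StandardNormal.

(** * Independence of events and of generated sigma-algebras *)

Section Independence.
Context {d : measure_display} {T : measurableType d} {R : realType}.
Variable P : probability T R.

(** As functions of [A], both sides are finite measures. They agree on the intersection-stable
    family [C], which contains the whole space, hence on the sigma-algebra it generates. *)
Lemma indep_sigma_algebra (C : set (set T)) (B : set T) :
  measurable B -> C `<=` measurable -> setI_closed C -> C setT ->
  (forall A, C A -> P (A `&` B) = P A * P B)%E ->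
  forall A, <<s C >> A -> (P (A `&` B) = P A * P B)%E.
Proof.
move=> mB Cm CI CT H A sA.
have fB : P B \is a fin_num by exact: fin_num_measure.
have r0 : 0 <= fine (P B) by rewrite fine_ge0.
pose r : {nonneg R} := NngNum r0.
have mscB E : mscale r P E = (P E * P B)%E by rewrite /mscale /= fineK // muleC.
rewrite -mscB.
apply: (@g_sigma_algebra_measure_unique _ R T C Cm (fun=> setT) _ _
  (mrestr P mB) (mscale r P)) => //.
- by apply/seteqP; split => // x _; exists 0.
- by move=> E CE; apply: etrans (H E CE) _; exact/esym/mscB.
- move=> _; rewrite /mrestr; apply: (le_lt_trans (probability_le1 _ _)).
    exact: measurableI.
  exact: ltry.
Qed.

(* The product law of (U, V) gives mass 0 to the diagonal. *)
Lemma indep_atomless_neq (U V : T -> R) :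
  measurable_fun setT U -> measurable_fun setT V ->
  (forall A B : set R, measurable A -> measurable B ->
    P (U @^-1` A `&` V @^-1` B) = P (U @^-1` A) * P (V @^-1` B))%E ->
  (forall x, P (V @^-1` [set x]) = 0%E) ->
  P [set t | U t = V t] = 0%E.
Proof.
move=> mU mV UV V0.
pose U' : {mfun T >-> measurableTypeR R} :=
  @mfun_Sub _ _ T (measurableTypeR R) U (mem_set mU).
pose V' : {mfun T >-> measurableTypeR R} :=
  @mfun_Sub _ _ T (measurableTypeR R) V (mem_set mV).
have mW : @measurable_fun _ _ T (measurableTypeR R * measurableTypeR R)%type
    setT (fun t => (U t, V t)) by exact: measurable_fun_pair.
pose W : {mfun T >-> (measurableTypeR R * measurableTypeR R)%type} :=
  @mfun_Sub _ _ T (measurableTypeR R * measurableTypeR R)%type _ (mem_set mW).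
pose D : set (measurableTypeR R * measurableTypeR R) := [set xy | xy.1 = xy.2].
have mD : measurable D.
  have -> : D = (fun xy : measurableTypeR R * measurableTypeR R => xy.1 - xy.2)
      @^-1` [set 0].
    by apply/seteqP; split => -[x y] /= /eqP; rewrite ?subr_eq0 => /eqP //= ->;
      rewrite subrr.
  rewrite -[X in measurable X]setTI; apply: measurable_funB => //.
(* By [UV] the joint law is the product law, so the mass of [D] is the integral of its sections,
   each a single point and null for the law of [V]. *)
apply: etrans (esym (@product_measure_unique _ _ _ _ R
  (distribution P U') (distribution P V') (distribution P W) UV D mD)) _.
rewrite /product_measure1 integral0_eq // => x _ /=.
have -> : xsection D x = [set x].
  by apply/seteqP; split => y; rewrite /xsection /= ?inE /D /= => ->.
exact: V0.
Qed.

(** * Sigma-algebras generated by blocks of variables *)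

Section Cylinders.
Context {I : finType}.
Variable Y : I -> T -> R.
Implicit Type S : {set I}.

(** Rectangles, rather than events on single variables, make the family stable under intersection.
    [<<s cylinder S >>] is the sigma-algebra generated by the [Y i] with [i] in [S]. *)
Definition cylinder S : set (set T) :=
  [set B | exists2 A : I -> set R, (forall i, measurable (A i)) &
     B = \bigcap_(i in [set` S]) (Y i @^-1` A i)].

Lemma cylinderT S : cylinder S setT.
Proof. by exists (fun=> setT) => //; apply/seteqP; split. Qed.

Lemma cylinder_setI_closed S : setI_closed (cylinder S).
Proof.
move=> _ _ [A mA ->] [B mB ->]; exists (fun i => A i `&` B i).
  by move=> i; exact: measurableI.
by rewrite -bigcapI.
Qed.

Lemma cylinder_subset S S' : S \subset S' -> cylinder S `<=` cylinder S'.
Proof.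
move=> /fintype.subsetP SS' _ [A mA ->].
exists (fun i => if i \in S then A i else setT); first by move=> i; case: ifP.
apply/seteqP; split => t H i /= iS; first by case: ifP => // /H.
by have := H _ (SS' _ iS); rewrite iS.
Qed.

Lemma cylinder_preimage S i A : i \in S -> measurable A ->
  cylinder S (Y i @^-1` A).
Proof.
move=> iS mA; exists (fun j => if j == i then A else setT).
  by move=> j; case: ifP.
apply/seteqP; split => t H; first by move=> j _ /=; case: eqP => // ->.
by have := H _ iS; rewrite /= eqxx.
Qed.

Lemma measurable_fun_cylinder S i : i \in S ->
  @measurable_fun _ _ (g_sigma_algebraType (cylinder S)) R setT (Y i).
Proof.
move=> iS _ A mA; rewrite setTI.
by apply: sub_sigma_algebra; exact: cylinder_preimage.
Qed.

Hypothesis indepY : mutually_independent P Y.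

Lemma cylinder_measurable S : cylinder S `<=` measurable.
Proof.
move=> _ [A mA ->]; apply: fin_bigcap_measurable => // i _.
rewrite -[X in measurable X]setTI.
by case: indepY => mY _; exact: mY.
Qed.

Lemma sigma_cylinder_measurable S : <<s cylinder S >> `<=` measurable.
Proof.
apply: smallest_sub; first exact: sigma_algebra_measurable.
exact: cylinder_measurable.
Qed.

(** Disjointness lets two rectangles be glued into one over [S :|: S'], whose probability is a
    product that splits along the two blocks. *)
Lemma indep_cylinders S S' A B : [disjoint S & S']%bool ->
  cylinder S A -> cylinder S' B -> (P (A `&` B) = P A * P B)%E.
Proof.
case: indepY => mY iY dS [F mF ->] [G mG ->].
pose H i := if i \in S then F i else G i.
have mH i : measurable (H i) by rewrite /H; case: ifP.
have HS i : i \in S -> H i = F i by rewrite /H => ->.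
have HS' i : i \in S' -> H i = G i.
  by rewrite /H => iS'; rewrite (disjointFl dS iS').
rewrite (iY S F) // (iY S' G) //.
have -> : (\prod_(i in S) P (Y i @^-1` F i) = \prod_(i in S) P (Y i @^-1` H i))%E.
  by apply: eq_bigr => i /HS ->.
have -> : (\prod_(i in S') P (Y i @^-1` G i) = \prod_(i in S') P (Y i @^-1` H i))%E.
  by apply: eq_bigr => i /HS' ->.
rewrite -bigU // (eq_bigl (mem (S :|: S'))); last first.
  by move=> i; rewrite !inE.
rewrite -iY //; congr (P _); apply/seteqP; split => t.
  move=> [tF tG] i /=; rewrite inE => /orP[iS|iS'].
    by rewrite HS //; exact: tF.
  by rewrite HS' //; exact: tG.
move=> tH; split => i iS; first by rewrite -HS //; apply: tH; rewrite /= inE iS.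
by rewrite -HS' //; apply: tH; rewrite /= inE iS orbT.
Qed.

(** Rectangles are replaced by general events one side at a time, the other side being held
    fixed. *)
Lemma indep_sigma_cylinders S S' A B : [disjoint S & S']%bool ->
  <<s cylinder S >> A -> <<s cylinder S' >> B -> (P (A `&` B) = P A * P B)%E.
Proof.
move=> dS sA sB.
have mA := sigma_cylinder_measurable _ _ sA.
have mB := sigma_cylinder_measurable _ _ sB.
apply: (indep_sigma_algebra (cylinder S)) => //.
- exact: cylinder_measurable.
- exact: cylinder_setI_closed.
- exact: cylinderT.
move=> E cE; rewrite setIC muleC.
apply: (indep_sigma_algebra (cylinder S')) => //.
- exact: cylinder_measurable cE.
- exact: cylinder_measurable.
- exact: cylinder_setI_closed.
- exact: cylinderT.
by move=> F cF; rewrite setIC muleC; exact: indep_cylinders cE cF.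
Qed.

(** The two conclusions are proved together: the induction needs the intersection of the tail events
    to lie in the sigma-algebra of the tail blocks, whose union is disjoint from the first block. *)
Lemma indep_family m (S : 'I_m -> {set I}) (E : 'I_m -> set T) :
  (forall l l', l != l' -> [disjoint S l & S l']%bool) ->
  (forall l, <<s cylinder (S l) >> (E l)) ->
  <<s cylinder (\bigcup_l S l)%SET >> [set t | forall l, E l t] /\
  P [set t | forall l, E l t] = (\prod_l P (E l))%E.
Proof.
elim: m S E => [|m IH] S E dS sE.
  have -> : [set t | forall l, E l t] = setT by apply/seteqP; split => // t _ [].
  rewrite !big_ord0 probability_setT; split=> //.
  by apply: sub_sigma_algebra; exact: cylinderT.
have [||sE' PE'] := IH (S \o lift ord0) (E \o lift ord0).
- by move=> l l' ll' /=; apply: dS; rewrite (inj_eq lift_inj).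
- by move=> l /=; exact: sE.
have -> : [set t | forall l, E l t] =
    E ord0 `&` [set t | forall l, (E \o lift ord0) l t].
  apply/seteqP; split => t; first by move=> H; split=> [|l]; exact: H.
  by move=> [H0 H] l; case: (unliftP ord0 l) => [l' ->|->] //; exact: H.
rewrite !big_ord_recl -PE'; split.
  apply: (@measurableI _ (g_sigma_algebraType (cylinder (S ord0 :|: _)))).
    by apply: sub_sigma_algebra2 (sE ord0); apply: cylinder_subset; exact: finset.subsetUl.
  by apply: sub_sigma_algebra2 sE'; apply: cylinder_subset; exact: finset.subsetUr.
apply: indep_sigma_cylinders (sE ord0) sE'.
apply/finset.bigcup_disjointP => l _.
by apply: dS; rewrite neq_lift.
Qed.

End Cylinders.
End Independence.

(** * Mutual independence tested on the full family *)

Section MutualIndependence.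
Context {d : measure_display} {T : measurableType d} {R : realType}.
Variable P : probability T R.

(** A subfamily is handled by putting [setT] outside [S], which contributes factors 1. *)
Lemma mutually_independent_full (I : finType) (Y : I -> T -> R) :
  (forall i, measurable_fun setT (Y i)) ->
  (forall A : I -> set R, (forall i, measurable (A i)) ->
    P [set t | forall i, A i (Y i t)] = (\prod_i P (Y i @^-1` A i))%E) ->
  mutually_independent P Y.
Proof.
move=> mY H; split=> // S A mA.
pose A' i := if i \in S then A i else setT.
have -> : \bigcap_(i in [set` S]) (Y i @^-1` A i) =
    [set t | forall i, A' i (Y i t)].
  apply/seteqP; split => t Ht i; rewrite /A'; first by case: ifP => // /Ht.
  by move=> /= iS; have := Ht i; rewrite /A' iS.
rewrite H; last by move=> i; rewrite /A'; case: ifP.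
rewrite [RHS]big_mkcond; apply: eq_bigr => i _; rewrite /A'.
by case: ifP => // _; rewrite preimage_setT probability_setT.
Qed.

Lemma mutually_independent_all (I : finType) (Y : I -> T -> R) A :
  mutually_independent P Y -> (forall i, measurable (A i)) ->
  P [set t | forall i, A i (Y i t)] = (\prod_i P (Y i @^-1` A i))%E.
Proof.
move=> [_ /(_ [set: I]%SET A) H] mA; have := H mA.
rewrite (eq_bigl xpredT) => [<-|i]; last by rewrite inE.
congr (P _); apply/seteqP; split => t Ht i /=; first by move=> _; exact: Ht.
by apply: Ht; rewrite /= inE.
Qed.

End MutualIndependence.

(** * Gaussian vectors: columns, symmetry, hyperplanes and boxes *)

Section GaussianVectors.
Context {d : measure_display} {T : measurableType d} {R : realType}.
Variable P : probability T R.

Lemma iid_std_normal_column p m (G : 'I_p -> 'I_m -> T -> R) (l : 'I_m) :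
  iid_std_normal P (fun ql : 'I_p * 'I_m => G ql.1 ql.2) ->
  iid_std_normal P (fun q => G q l).
Proof.
move=> [[mG iG] nG]; split; last by move=> q A mA; exact: (nG (q, l)).
apply: mutually_independent_full => [q|A mA]; first exact: (mG (q, l)).
have inj : injective (fun q : 'I_p => (q, l)) by move=> q q' [].
have := iG [set (q, l) | q in [set: 'I_p]%SET]%SET (fun ql => A ql.1) (fun ql => mA ql.1).
rewrite big_imset /=; last by move=> q q' _ _ /inj.
rewrite (eq_bigl xpredT) => [<-|i]; last by rewrite inE.
congr (P _); apply/seteqP; split => t Ht.
  by move=> _ /imsetP[q _ ->]; exact: Ht.
by move=> q; apply: (Ht (q, l)); rewrite /= imset_f // inE.
Qed.

Lemma iid_std_normal_opp (I : finType) (Y : I -> T -> R) :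
  iid_std_normal P Y -> iid_std_normal P (fun i t => - Y i t).
Proof.
move=> [[mY iY] nY].
have mN (A : set R) : measurable A -> measurable (-%R @^-1` A).
  by move=> mA; rewrite -[X in measurable X]setTI; exact: oppr_measurable.
split; last first.
  move=> i A mA; by rewrite -[RHS]normal_prob_opp // -(nY i) //; exact: mN.
split=> [i|S A mA]; first exact: measurableT_comp.
exact: (iY S (fun i => -%R @^-1` A i) (fun i => mN _ (mA i))).
Qed.

(** Solved for a coordinate [q] with [a 0 q != 0], the equation reads [U = z q], where [U] depends
    on the other coordinates only. It is therefore independent of [z q], whose law has no atoms. *)
Lemma gaussian_hyperplane_null p (z : 'I_p -> T -> R) (a : 'rV[R]_p) :
  iid_std_normal P z -> a != 0 -> P [set t | dotp (\row_j z j t) a = 0] = 0%E.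
Proof.
move=> [iz nz] /eqP a0; have mz := iz.1.
have [q aq] : exists q, a 0 q != 0.
  apply: contrapT => H; apply: a0; apply/rowP => q; rewrite mxE.
  by apply/eqP/negPn/negP => aq; apply: H; exists q.
pose U t := \sum_j (if j == q then 0 else - a 0 j / a 0 q) * z j t.
have mUS : @measurable_fun _ _ (g_sigma_algebraType (cylinder z (~: [set q])%SET)) R
    setT U.
  apply: measurable_sum => j; case: eqVneq => [_|jq].
    by under eq_fun do rewrite mul0r; exact: measurable_cst.
  apply: measurable_funM; first exact: measurable_cst.
  by apply: measurable_fun_cylinder; rewrite !inE.
have UV A B : measurable A -> measurable B ->
    (P (U @^-1` A `&` z q @^-1` B) = P (U @^-1` A) * P (z q @^-1` B))%E.
  move=> mA mB; apply: (@indep_sigma_cylinders _ _ _ P _ z iz (~: [set q])%SET [set q]%SET).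
  - by rewrite disjoint_sym disjoints1 !inE eqxx.
  - by rewrite -[X in <<s _ >> X]setTI; exact: mUS.
  - by apply: sub_sigma_algebra; apply: cylinder_preimage; rewrite ?inE.
have mU : measurable_fun setT U.
  move=> _ A mA; rewrite setTI.
  apply: (@sigma_cylinder_measurable _ _ _ P _ z iz (~: [set q])%SET).
  by rewrite -[X in <<s _ >> X]setTI; exact: mUS.
have := @indep_atomless_neq _ _ _ P U (z q) mU (mz q) UV.
have -> : [set t | U t = z q t] = [set t | dotp (\row_j z j t) a = 0].
  have key t : dotp (\row_j z j t) a = a 0 q * (z q t - U t).
    rewrite /dotp /U (bigD1 q) //= [in RHS](bigD1 q) //= eqxx mul0r add0r mulrBr.
    rewrite mxE mulrC; congr (_ + _); rewrite mulr_sumr -sumrN.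
    apply: eq_bigr => j /negbTE ->; by rewrite mxE; field.
  apply/seteqP; split => t /=; rewrite key => /eqP.
    by move=> /eqP ->; rewrite subrr mulr0.
  by rewrite mulf_eq0 (negbTE aq) subr_eq0 => /eqP.
by apply=> x; rewrite nz // normal_prob_set1.
Qed.

Lemma gaussian_box_gt0 p (z : 'I_p -> T -> R) (w : 'rV[R]_p) (e : R) :
  iid_std_normal P z -> 0 < e ->
  (0 < P [set t | forall j, (`|z j t - w 0 j| < e)%R])%E.
Proof.
move=> [iz nz] e0.
have -> : [set t | forall j, `|z j t - w 0 j| < e] =
    [set t | forall j, `]w 0 j - e, w 0 j + e[%classic (z j t)].
  apply/seteqP; split => t H j; have := H j; rewrite /= in_itv /= ltr_norml;
    lra.
rewrite (mutually_independent_all _ _ z (fun j => `]w 0 j - e, w 0 j + e[%classic)) //.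
elim/big_ind: _ => [|x y x0 y0|j _]; [exact: lte01|exact: mule_gt0|].
rewrite nz //; apply: normal_prob_itv_gt0; lra.
Qed.

End GaussianVectors.

(** [solid_angle_is] constrains its value only through spaces that carry a Gaussian vector, so one
    is built, adding a coordinate at a time by a product with the normal law. *)
Lemma iid_std_normal_exists (R : realType) (p : nat) :
  exists (d : measure_display) (T : measurableType d) (P : probability T R)
    (z : 'I_p -> T -> R), iid_std_normal P z.
Proof.
elim: p => [|p [d [T [P [z [[mz iz] nz]]]]]].
  exists _, (measurableTypeR R), (normal_prob 0 1), (fun=> id); split; last by case.
  apply: mutually_independent_full => [|A _]; first by case.
  rewrite big_ord0 (_ : [set t | _] = setT) ?probability_setT //.
  by apply/seteqP; split => // t _ [].
pose Q : probability (T * measurableTypeR R)%type R := (P \x normal_prob 0 1)%E.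
(* Index [ord0] reads the new factor; the other indices read the old space. *)
pose z' (j : 'I_p.+1) (t : T * measurableTypeR R) : R :=
  if unlift ord0 j is Some i then z i t.1 else t.2.
have mpre i A : measurable A -> measurable (z i @^-1` A).
  by move=> mA; rewrite -[X in measurable X]setTI; exact: mz.
have Q0 (A : set R) : measurable A -> Q (z' ord0 @^-1` A) = normal_prob 0 1 A.
  move=> mA; have -> : z' ord0 @^-1` A = setT `*` A.
    by apply/seteqP; split => t /=; rewrite /z' unlift_none //; case.
  by rewrite [LHS]product_measure1E // [X in (X * _)%E]probability_setT mul1e.
have QS i (A : set R) : measurable A -> Q (z' (lift ord0 i) @^-1` A) = P (z i @^-1` A).
  move=> mA; have -> : z' (lift ord0 i) @^-1` A = (z i @^-1` A) `*` setT.
    by apply/seteqP; split => t /=; rewrite /z' liftK //; case.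
  rewrite [LHS]product_measure1E //; last exact: mpre.
  by rewrite [X in (_ * X)%E]probability_setT mule1.
exists _, (T * measurableTypeR R)%type, Q, z'; split; last first.
  move=> j A mA; case: (unliftP ord0 j) => [i ->|->]; last exact: Q0.
  by rewrite QS // nz.
apply: mutually_independent_full => [j|A mA].
  rewrite /z'; case: unlift => [i|]; last exact: measurable_snd.
  by apply: measurableT_comp => //; exact: measurable_fst.
have -> : [set t | forall j, A j (z' j t)] =
    [set t | forall i, A (lift ord0 i) (z i t)] `*` A ord0.
  apply/seteqP; split => t /=.
    move=> H; split=> [i|]; first by have := H (lift ord0 i); rewrite /z' liftK.
    by have := H ord0; rewrite /z' unlift_none.
  move=> [H H0] j; rewrite /z'.
  by case: (unliftP ord0 j) => [i ->|->]; rewrite ?liftK ?unlift_none.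
have mB : measurable [set t | forall i, A (lift ord0 i) (z i t)].
  have -> : [set t | forall i, A (lift ord0 i) (z i t)] =
      \bigcap_(i in setT) (z i @^-1` A (lift ord0 i)).
    by apply/seteqP; split => t H i; [move=> _|]; exact: H.
  by apply: fin_bigcap_measurable => // i _; exact: mpre.
rewrite [LHS]product_measure1E //; last exact: mA.
rewrite big_ord_recl Q0 // muleC; congr (_ * _)%E.
apply: (etrans (mutually_independent_all P _ z (fun i => A (lift ord0 i)) _ _)) => //.
by apply: eq_bigr => i _; rewrite QS.

Qed.

(** * Solid angles of normal cones and the rows selected by a column *)

Section SolidAngle.
Context {R : realType} {n p : nat}.
Variable X : 'M[R]_(n, p).

Local Notation N x := (normal_cone (conv_rows X) x).

Section Measurability.
Context {d : measure_display} {T : measurableType d}.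
Variable z : 'I_p -> T -> R.
Hypothesis mz : forall j, measurable_fun setT (z j).

Lemma measurable_dotp (a : 'rV[R]_p) :
  measurable_fun setT (fun t => dotp (\row_j z j t) a).
Proof.
apply: measurable_sum => j; apply: measurable_funM; last exact: measurable_cst.
by under eq_fun do rewrite mxE; exact: mz.
Qed.

(** The measurable space is arbitrary, so that the sigma-algebra generated by a single column can be
    used for it. *)
Lemma measurable_normal_cone x : measurable [set t | N x (\row_j z j t)].
Proof.
have -> : [set t | N x (\row_j z j t)] =
    \bigcap_(j in [set: 'I_n])
      ((fun t => dotp (\row_j z j t) (row j X - x)) @^-1` `]-oo, 0]).
  apply/seteqP; split => t /=.
    by move=> /normal_coneE H j _; rewrite /= in_itv /=; exact: H.
  move=> H; apply/normal_coneE => j.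
  by have := H j I; rewrite /= in_itv /=.
apply: fin_bigcap_measurable => // j _.
rewrite -[X in measurable X]setTI; exact: measurable_dotp.
Qed.

End Measurability.

Lemma solid_angle_gt0 x (w : R) :
  extreme_point (conv_rows X) x -> solid_angle_is (N x) w -> 0 < w.
Proof.
move=> /normal_cone_contains_box[v [e e0 box]] solid.
have [d [T [P [z iz]]]] := iid_std_normal_exists R p.
have mz := iz.1.1.
rewrite -lte_fin -(solid _ _ _ _ iz).
apply: lt_le_trans (gaussian_box_gt0 P _ z v e iz e0) _.
apply: le_measure; rewrite ?inE.
- have -> : [set t | forall j, `|z j t - v 0 j| < e] =
      \bigcap_(j in [set: 'I_p]) (z j @^-1` `]v 0 j - e, v 0 j + e[).
    apply/seteqP; split => t H j; [move=> _|]; [have := H j|have := H j I];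
      rewrite /= in_itv /= ltr_norml; lra.
  apply: fin_bigcap_measurable => // j _.
  by rewrite -[X in measurable X]setTI; exact: mz.
- exact: measurable_normal_cone.
- by move=> t H; apply: box => j; rewrite mxE.
Qed.

(** The maximum with 0 covers the case where all rows equal [x]: the cone is then the whole space,
    nothing is missed, and [1 - 2 * w] is negative. *)
Lemma prob_missed_le {d : measure_display} {T : measurableType d}
    (P : probability T R) (z : 'I_p -> T -> R) x (w : R) :
  solid_angle_is (N x) w -> iid_std_normal P z ->
  (P (~` ([set t | N x (\row_j z j t)] `|` [set t | N x (\row_j - z j t)%R]))
    <= (Num.max 0 (1 - 2 * w))%:E)%E.
Proof.
move=> solid iz; have izN := iid_std_normal_opp P _ z iz.
set A := [set t | _]; set B := [set t | N x (\row_j - z j t)].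
have mA : measurable A by exact: measurable_normal_cone iz.1.1 _.
have mB : measurable B by exact: measurable_normal_cone izN.1.1 _.
have PA : P A = w%:E by exact: solid iz.
have PB : P B = w%:E by exact: solid izN.
have [all_eq|jx] := pselect (forall j, row j X = x); last first.
  have [j {}jx] : exists j, row j X != x.
    by apply: contrapT => H; apply: jx => j; apply/eqP/negPn/negP => ?; apply: H; exists j.
  have PAB : P (A `&` B) = 0%E.
    (* A vector in the cone and in its opposite has product both [<= 0] and [>= 0] with
       [row j X - x]. *)
    apply: (@subset_measure0 _ _ _ P _ [set t | dotp (\row_j z j t) (row j X - x) = 0]).
    - exact: measurableI.
    - rewrite -[X in measurable X]setTI.
      exact: (measurable_dotp _ iz.1.1 _ measurableT _ (measurable_set1 0)).
    - move=> t [/normal_coneE At /normal_coneE Bt] /=; apply/eqP.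
      rewrite eq_le At -oppr_le0 -dotpNl.
      suff -> : - (\row_j z j t) = \row_j - z j t by rewrite Bt.
      by apply/rowP => q; rewrite !mxE.
    - by apply: gaussian_hyperplane_null => //; rewrite subr_eq0.
  have PU : P (A `|` B) = (w + w)%:E.
    transitivity (P A + P B - P (A `&` B))%E.
      by apply: measureUfinl => //; exact: le_lt_trans (probability_le1 P mA) (ltry 1).
    by rewrite PA PB PAB sube0.
  rewrite probability_setC; last exact: measurableU.
  by rewrite PU -EFinB lee_fin le_max; apply/orP; right; lra.
suff -> : ~` (A `|` B) = set0 by rewrite measure0 lee_fin le_max lexx.
apply/seteqP; split => // t; apply; left; apply/normal_coneE => j.
by rewrite all_eq dotpBr subrr.
Qed.

(** Maximality of row [j] in a column is the row form of membership in the cone, and minimality is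
    the same for the opposite column. Any index of a row equal to [x] will do, ties included. *)
Lemma selectedE (T : Type) m (G : 'I_p -> 'I_m -> T -> R) t j x :
  row j X = x ->
  selected X G t j <->
  exists l, ([set t | N x (\row_q G q l t)] `|` [set t | N x (\row_q - G q l t)]) t.
Proof.
move=> jx.
have entry j' l : XG_entry X G t j' l = dotp (\row_q G q l t) (row j' X).
  by apply: eq_bigr => q _; rewrite !mxE mulrC.
have opp l : \row_q - G q l t = - \row_q G q l t by apply/rowP => q; rewrite !mxE.
split=> -[l H]; exists l; case: H => H; [left|right|left|right].
- by apply/normal_coneE => j'; have := H j'; rewrite !entry dotpBr subr_le0 jx.
- apply/normal_coneE => j'; have := H j'.
  by rewrite /= opp !entry dotpNl dotpBr oppr_le0 subr_ge0 jx.
- by move: H => /normal_coneE H j'; have := H j'; rewrite !entry dotpBr subr_le0 jx.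
- move: H; rewrite /= opp => /normal_coneE H j'; have := H j'.
  by rewrite !entry dotpNl dotpBr oppr_le0 subr_ge0 jx.
Qed.

End SolidAngle.

(** * The numerical bound on the number of columns *)

(* For [M <= 0] the junk values [1 / 0 = 0] and [ln y = 0] for [y <= 0] make
   the left-hand side of the hypothesis vanish. *)
Lemma sample_size_bound {R : realType} (k m : nat) (M delta : R) :
  (0 < k)%N -> 0 < delta < 1 -> M < 1 ->
  1 / ln (1 / M) * ln (k%:R / delta) < m%:R ->
  k%:R * Num.max 0 M ^+ m <= delta.
Proof.
move=> k0 /andP[d0 d1] M1 H.
have kd : 1 < k%:R / delta.
  by rewrite ltr_pdivlMr // mul1r (lt_le_trans d1) // ler1n.
have [M0|M0] := lerP M 0.
  have lnM : ln (1 / M) = 0 by rewrite ln0 // div1r invr_le0.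
  (* The hypothesis has become [0 < m], which is what makes the power of 0 vanish. *)
  have m0 : (0 < m)%N by move: H; rewrite lnM invr0 mulr0 mul0r ltr0n.
  by rewrite expr0n gtn_eqF // mulr0 ltW.
have lnM : ln (1 / M) = - ln M by rewrite div1r lnV ?posrE.
have lnM0 : ln M < 0 by rewrite ln_lt0 // M0 M1.
move: H; rewrite lnM mulrAC mul1r ltr_pdivrMr ?oppr_gt0 // => H.
have kr : 0 < k%:R :> R by rewrite ltr0n.
(* The goal is put in the form [M ^+ m <= delta / k%:R] and logarithms are taken. *)
rewrite mulrC -ler_pdivlMr // -ler_ln ?posrE ?exprn_gt0 ?divr_gt0 //.
rewrite lnXn // ltW //; move: H.
have -> : delta / k%:R = (k%:R / delta)^-1 by rewrite invf_div.
rewrite [ln _^-1]lnV ?posrE ?divr_gt0 // -mulr_natl; lra.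
Qed.

(** * Product over the columns and union bound over the extreme points *)

Lemma prode_le_exprn {R : realType} m (x : 'I_m -> \bar R) (e : R) :
  (forall l, 0 <= x l <= e%:E)%E -> (\prod_(l < m) x l <= (e ^+ m)%:E)%E.
Proof.
elim: m x => [|m IH] x H; first by rewrite big_ord0 expr0.
rewrite big_ord_recl exprS EFinM; have /andP[x0 xe] := H ord0.
apply: lee_pmul => //; last exact: IH.
by apply: prode_ge0 => l _; case/andP: (H (lift ord0 l)).
Qed.

Lemma measure_bigsetU_le {d : measure_display} {T : measurableType d}
    {R : realType} (P : {measure set T -> \bar R}) (I : Type) (r : seq I)
    (F : I -> set T) : (forall i, measurable (F i)) ->
  (P (\big[setU/set0]_(i <- r) F i) <= \sum_(i <- r) P (F i))%E.
Proof.
move=> mF; elim: r => [|i r IH]; first by rewrite !big_nil measure0.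
rewrite !big_cons; apply: le_trans (leeD2l _ IH).
by apply: measureU2 => //; exact: bigsetU_measurable.
Qed.

Theorem theorem1 (R : realType) (n p k m : nat) (X : 'M[R]_(n, p))
  (h : 'I_k -> 'rV[R]_p) (omega : 'I_k -> R) (delta : R)
  (d : measure_display) (T : measurableType d) (P : probability T R)
  (G : 'I_p -> 'I_m -> T -> R) :
  injective h ->
  (forall x, extreme_point (conv_rows X) x <-> exists i, x = h i) ->
  (forall i, solid_angle_is (normal_cone (conv_rows X) (h i)) (omega i)) ->
  0 < delta < 1 ->
  iid_std_normal P (fun ql : 'I_p * 'I_m => G ql.1 ql.2) ->
  let kappa := 1 / ln (1 / \big[Num.max/-1]_(i < k) (1 - 2 * omega i)) in
  m%:R > kappa * ln (k%:R / delta) ->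
  (P [set t | forall i : 'I_k, exists j : 'I_n, selected X G t j /\ row j X = h i]
    >= (1 - delta)%:E)%E.
Proof.
move=> _ extE solid d01 iG kappa Hm.
have ext i : extreme_point (conv_rows X) (h i) by apply/extE; exists i.
pose hit i l := [set t | normal_cone (conv_rows X) (h i) (\row_q G q l t)] `|`
  [set t | normal_cone (conv_rows X) (h i) (\row_q - G q l t)].
pose missed i := [set t | forall l, (~` hit i l) t].
(* Failure means that some extreme point is missed by every column. *)
have -> : [set t | forall i, exists j, selected X G t j /\ row j X = h i] =
    ~` \big[setU/set0]_(i < k) missed i.
  rewrite -bigcup_seq; apply/seteqP; split => t /=.
    move=> H [i _]; have [j [sel jh]] := H i; apply/existsNP.
    by have /(selectedE _ _ _ _ _ _ _ jh) [l Hl] := sel; exists l; apply.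
  move=> H i; have [j jh] := extreme_point_row _ _ (ext i); exists j; split=> //.
  apply/(selectedE _ _ _ _ _ _ _ jh); apply: contrapT => /forallNP miss.
  by apply: H; exists i; rewrite //= mem_index_enum.
pose col (l : 'I_m) := [set (q, l) | q in [set: 'I_p]%SET]%SET.
pose Y (ql : 'I_p * 'I_m) := G ql.1 ql.2.
(* Whether column [l] hits point [i] is decided by the entries of that column, and distinct columns
   are disjoint blocks; this gives independence over [l]. *)
have sigma_hit i l : <<s cylinder Y (col l) >> (~` hit i l).
  pose TC : measurableType _ := g_sigma_algebraType (cylinder Y (col l)).
  have mG q : @measurable_fun _ _ TC R setT (G q l).
    by apply: (measurable_fun_cylinder Y _ (q, l)); rewrite imset_f // inE.
  apply: (@measurableC _ TC); apply: (@measurableU _ TC);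
    apply: (@measurable_normal_cone _ _ _ _ _ TC) => // q.
  exact: measurableT_comp.
have col_disj l l' : l != l' -> [disjoint col l & col l']%bool.
  move=> ll'; rewrite -setI_eq0; apply/eqP/setP => -[q r]; rewrite !inE.
  apply/negP => /andP[/imsetP[q1 _ [_ E1]] /imsetP[q2 _ [_ E2]]].
  by move: ll'; rewrite -E1 -E2 eqxx.
pose M : R := \big[Num.max/-1]_(i < k) (1 - 2 * omega i).
have mmissed i : measurable (missed i).
  have [S _] := indep_family P _ iG.1 _ col (fun l => ~` hit i l) col_disj (sigma_hit i).
  exact: (sigma_cylinder_measurable P _ iG.1 _ _ S).
have mU : measurable (\big[setU/set0]_(i < k) missed i).
  exact: bigsetU_measurable.
have bound : k%:R * Num.max 0 M ^+ m <= delta.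
  have [k0|k0] := posnP k.
    by rewrite (_ : k%:R = 0) ?k0 // mul0r; case/andP: d01 => /ltW.
  apply: sample_size_bound => //.
  (* [M < 1] because every solid angle is positive; the default [-1] of the maximum is also below
     1. *)
  rewrite /M; elim/big_ind: _ => [|x y x1 y1|i _]; first lra.
    by rewrite gt_max x1 y1.
  by have := solid_angle_gt0 _ _ _ (ext i) (solid i); lra.
(* The probability factors over the columns, and each factor is at most
   [Num.max 0 (1 - 2 * omega i)], hence at most [Num.max 0 M]. *)
have Pmissed i : (P (missed i) <= (Num.max 0 M ^+ m)%:E)%E.
  have [_ ->] := indep_family P _ iG.1 _ col (fun l => ~` hit i l) col_disj (sigma_hit i).
  apply: prode_le_exprn => l; rewrite measure_ge0 /=.
  apply: le_trans (prob_missed_le _ _ _ _ _ (solid i) (iid_std_normal_column _ _ _ _ l iG)) _.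
  by rewrite lee_fin ge_max !le_max lexx /= (le_bigmax _ (fun i => 1 - 2 * omega i)) orbT.
rewrite probability_setC // EFinB leeB //.
apply: le_trans (measure_bigsetU_le _ _ _ _ mmissed) _.
apply: (@le_trans _ _ (\sum_(i < k) (Num.max 0 M ^+ m)%:E)%E).
  by apply: lee_sum => i _; exact: Pmissed.
by rewrite sumEFin lee_fin sumr_const card_ord -mulr_natl.
Qed.
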